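(* Let $\beta>1$ be a constant. For every minimization problem, every instance $I$ of it, and every solution $S=\{x_0,\dots,x_k\}$ constructed for $I$ by a present-biased agent with parameter $\beta$, the cost ratio satisfies $$\varrho=\frac{c(S)}{\mathrm{opt}(I)}\le\beta .$$
   Context: **Minimization problems.** An instance $I$ consists of a finite nonempty ground set $\mathcal S_I$, a weight function $\omega:\mathcal S_I\to\mathbb N$ (where $\mathbb N=\{1,2,\dots\}$), and a family $F(I)$ of subsets of $\mathcal S_I$, called feasible solutions, that contains $\mathcal S_I$ and is closed upward: $S\in F(I)$ and $S\subseteq S'\subseteq\mathcal S_I$ imply $S'\in F(I)$. The cost of $S$ is $c(S)=\sum_{x\in S}\omega(x)$, and $\mathrm{opt}(I)=\min_{S\in F(I)}c(S)$. For $x\in\mathcal S_I$, $I\smallsetminus\{x\}$ is the instance with ground set $\mathcal S_I\smallsetminus\{x\}$, the same weights, and feasible solutions $S\smallsetminus\{x\}$ for $S\in F(I)$. A minimization problem is a class of such instances closed under $I\mapsto I\smallsetminus\{x\}$. The initial instance $I$ is assumed to satisfy $\emptyset\notin F(I)$, so that $\mathrm{opt}(I)>0$. **Present-biased agent with parameter $\beta$.** Put $I_0=I$. At step $i\ge0$, the agent computes a pair $(S_i,x_i)$ with $S_i\in F(I_i)$ and $x_i\in S_i$ that minimizes the perceived cost $\omega(x)+\beta\,c(S\smallsetminus\{x\})$ among all pairs $(S,x)$ with $S\in F(I_i)$ and $x\in S$, and selects $x_i$. Ties are broken arbitrarily. The agent stops as soon as $\{x_0,\dots,x_i\}\in F(I)$;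 otherwise it continues with $I_{i+1}=I_i\smallsetminus\{x_i\}$. *)

(* Defs.v *)
From mathcomp Require Import all_boot all_order all_algebra.

Set Implicit Arguments.
Unset Strict Implicit.
Unset Printing Implicit Defensive.

Import Order.TTheory GRing.Theory Num.Theory.
Local Open Scope ring_scope.

(* The ground set is a subset of a carrier type, so that deleting an element
   does not change the type. Weights outside [ground] play no role. *)
Record instance (T : finType) := Instance {
  ground : {set T};
  weight : T -> nat;
  feas : {set {set T}}
}.

Definition is_instance (T : finType) (I : instance T) : Prop :=
  [/\ ground I != set0,
      forall x, x \in ground I -> (0 < weight I x)%N,
      forall S, S \in feas I -> S \subset ground I,
      ground I \in feas I
    & forall S S' : {set T}, S \in feas I -> S \subset S' ->
        S' \subset ground I -> S' \in feas I].

Definition cost (T : finType) (I : instance T) (S : {set T}) : nat :=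
  (\sum_(x in S) weight I x)%N.

Definition opt (T : finType) (I : instance T) : nat :=
  cost I [arg min_(S < ground I in feas I) cost I S]%N.

Definition del (T : finType) (I : instance T) (x : T) : instance T :=
  Instance (ground I :\ x) (weight I) [set S :\ x | S in feas I].

(* Closure under deletion cannot be required when the ground set is a
   singleton, since ground sets of instances are nonempty. *)
Record min_problem := MinProblem {
  mem_problem :> forall T : finType, instance T -> Prop;
  mem_problem_instance : forall (T : finType) (I : instance T),
    mem_problem I -> is_instance I;
  mem_problem_del : forall (T : finType) (I : instance T) (x : T),
    mem_problem I -> x \in ground I -> ground I :\ x != set0 ->
    mem_problem (del I x)
}.

Section Agent.
Variables (R : realFieldType) (beta : R) (T : finType).
Implicit Types (I : instance T).

Definition perceived_cost I (S : {set T}) (x : T) : R :=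
  (weight I x)%:R + beta * (cost I (S :\ x))%:R.

Definition agent_choice I (S : {set T}) (x : T) : Prop :=
  [/\ S \in feas I, x \in S
    & forall (S' : {set T}) x', S' \in feas I -> x' \in S' ->
        perceived_cost I S x <= perceived_cost I S' x'].

Fixpoint residual I (x : nat -> T) (i : nat) : instance T :=
  if i is j.+1 then del (residual I x j) (x j) else I.

Definition selected (x : nat -> T) (i : nat) : {set T} :=
  [set x (j : nat) | j : 'I_i.+1].

(* Only the values of [S] and [x] at 0, ..., k are constrained. *)
Definition agent_run I (k : nat) (S : nat -> {set T}) (x : nat -> T) : Prop :=
  [/\ forall i, (i <= k)%N -> agent_choice (residual I x i) (S i) (x i),
      forall i, (i < k)%N -> selected x i \notin feas I
    & selected x k \in feas I].

Definition constructed_by_agent I (A : {set T}) : Prop :=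
  exists k S x, agent_run I k S x /\ A = selected x k.

Definition cost_ratio I (A : {set T}) : R := (cost I A)%:R / (opt I)%:R.

End Agent.

(* Main.v *)
(** Let [p i] be the perceived cost at step [i]. The rest [S i :\ x i] of the
    announced solution is feasible for the next instance, and any pair built on
    it has perceived cost at most [beta * c(S i :\ x i) = p i - w(x i)]. Hence
    [p i.+1 + w(x i) <= p i], so the weights actually paid sum to at most [p 0],
    which is at most [beta * opt] because an optimal solution is a candidate. *)
Require Import Defs.
From mathcomp Require Import all_boot all_order all_algebra.

Set Implicit Arguments.
Unset Strict Implicit.
Unset Printing Implicit Defensive.

Import Order.TTheory GRing.Theory Num.Theory.
Local Open Scope ring_scope.

Lemma weight_residual (T : finType) (I : instance T) (x : nat -> T) i :
  weight (residual I x i) = weight I.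
Proof. by elim: i. Qed.

(** Successive deletions amount to a single set difference. This traces a residual solution back to
    [I], where upward closure is available. *)
Lemma feas_residualP (T : finType) (I : instance T) (x : nat -> T) i S :
  S \in feas (residual I x i) ->
  exists2 S', S' \in feas I & S = S' :\: [set x (j : nat) | j : 'I_i].
Proof.
elim: i S => [|i IHi] S /= feasS.
  exists S => //; apply/setP => y; rewrite inE.
  by case: imsetP => // -[[]].
have /imsetP[S1 /IHi[S' feasS' ->] ->] := feasS.
exists S' => //; apply/setP => y; rewrite !inE andbA; congr (_ && _).
rewrite -negb_or; congr (~~ _); apply/orP/imsetP.
  case=> [/eqP -> | /imsetP[j _ ->]]; first by exists ord_max.
  by exists (widen_ord (leqnSn i) j).
case=> j _ ->; have := ltn_ord j; rewrite ltnS leq_eqVlt.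
case/orP => [/eqP -> | ltji]; first by left.
by right; apply/imsetP; exists (Ordinal ltji).
Qed.

(** An inequality suffices and spares a proof that the agent never repeats an element: group the
    indices by their value under [x], and each group has at least one index. *)
Lemma cost_imset_le (T : finType) (I : instance T) (x : nat -> T) n :
  (cost I [set x (j : nat) | j : 'I_n] <= \sum_(j < n) weight I (x j))%N.
Proof.
rewrite /cost (partition_big_imset (fun j : 'I_n => x j)) /=.
apply: leq_sum => y /imsetP[j _ ->].
by rewrite (bigD1 j) //= leq_addr.
Qed.

Lemma costD1 (T : finType) (I : instance T) (S : {set T}) x :
  x \in S -> cost I S = (weight I x + cost I (S :\ x))%N.
Proof.
move=> xS; rewrite /cost (bigD1 x) //=; congr (_ + _)%N.
by apply: eq_bigl => y; rewrite !inE andbC.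
Qed.

Section PresentBias.
Variables (R : realFieldType) (beta : R) (T : finType) (I : instance T).
Hypothesis beta_ge1 : 1 <= beta.

(** Picking [x] first only lowers the factor on its weight from [beta] to 1. *)
Lemma perceived_cost_le (S : {set T}) x :
  x \in S -> perceived_cost beta I S x <= beta * (cost I S)%:R.
Proof.
move=> xS; rewrite /perceived_cost (costD1 _ xS) natrD mulrDr lerD2r.
by rewrite ler_peMl.
Qed.

Lemma agent_choice_le (S S' : {set T}) x :
  agent_choice beta I S x -> S' \in feas I -> S' != set0 ->
  perceived_cost beta I S x <= beta * (cost I S')%:R.
Proof.
move=> [_ _ minSx] feasS' /set0Pn[y yS'].
exact: le_trans (minSx _ _ feasS' yS') (perceived_cost_le yS').
Qed.

End PresentBias.

Section AgentRun.
Variables (R : realFieldType) (beta : R) (T : finType) (I : instance T).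
Variables (k : nat) (S : nat -> {set T}) (x : nat -> T).
Hypotheses (beta_ge1 : 1 <= beta) (instI : is_instance I).
Hypothesis runI : agent_run beta I k S x.

Let p i := perceived_cost beta (residual I x i) (S i) (x i).

Lemma run_mem_ground i : (i <= k)%N -> x i \in ground I.
Proof.
case: instI runI => _ _ subI _ _ [choice _ _] /choice[feasS xS _].
have [S' /subI/subsetP sub' eqS] := feas_residualP feasS.
by apply: sub'; move: xS; rewrite eqS inE => /andP[].
Qed.

(** Were the empty set feasible here, the elements selected up to step [i] would contain a feasible
    solution of [I]; by upward closure the agent would already have stopped. *)
Lemma run_residual_solution_neq0 i S' :
  (i < k)%N -> S' \in feas (residual I x i.+1) -> S' != set0.
Proof.
move=> ltik feasS'; apply: contraTneq feasS' => ->.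
apply: contraTN isT => /feas_residualP[S1 feasS1 /esym/eqP].
rewrite setD_eq0 => sub1; case: instI runI => _ _ _ _ upI [_ notfeas _].
have /negP[] := notfeas i ltik; apply: upI feasS1 sub1 _.
apply/subsetP => y /imsetP[j _ ->]; apply: run_mem_ground.
by apply: leq_trans (ltnW ltik); rewrite -ltnS.
Qed.

Lemma run_perceived_cost_step i :
  (i < k)%N -> (weight I (x i))%:R + p i.+1 <= p i.
Proof.
move=> ltik; case: runI => choice _ _.
have [feasS xS _] := choice i (ltnW ltik).
have feasS' : S i :\ x i \in feas (residual I x i.+1) by apply: imset_f.
rewrite {2}/p /perceived_cost weight_residual lerD2l.
(* Since [del] keeps the weights, costs in consecutive residual instances agree by conversion. *)
exact: agent_choice_le (choice _ ltik) feasS' (run_residual_solution_neq0 _ feasS').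
Qed.

Lemma run_paid_le i :
  (i <= k)%N -> (\sum_(j < i) weight I (x j))%:R + p i <= p 0.
Proof.
elim: i => [|i IHi] leik; first by rewrite big_ord0 add0r.
apply: le_trans (IHi (ltnW leik)); rewrite big_ord_recr natrD -addrA lerD2l.
exact: run_perceived_cost_step.
Qed.

Lemma cost_selected_le : (cost I (selected x k))%:R <= p 0.
Proof.
apply: le_trans (run_paid_le (leqnn k)).
apply: le_trans (_ : (\sum_(j < k.+1) weight I (x j))%:R <= _).
  by rewrite ler_nat cost_imset_le.
(* The sum in [run_paid_le] stops just before step [k]; the last payment is the first term of [p k],
   whose other term is nonnegative. *)
rewrite big_ord_recr natrD lerD2l /p /perceived_cost weight_residual lerDl.
by rewrite mulr_ge0 // (le_trans ler01).
Qed.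

End AgentRun.

Theorem theorem4 (R : realFieldType) (beta : R) (hbeta : 1 < beta)
    (P : min_problem) (T : finType) (I : instance T) (hI : P T I)
    (h0 : set0 \notin feas I)
    (A : {set T}) (hA : constructed_by_agent beta I A) :
  cost_ratio R I A <= beta.
Proof.
have instI := mem_problem_instance hI; have beta_ge1 := ltW hbeta.
case: hA => k [S [x [run ->]]]; rewrite /cost_ratio /opt.
have [_ posI subI fullI _] := instI.
case: arg_minnP => // O feasO _.
have O_neq0 : O != set0 by apply: contraNneq h0 => <-.
have costO_gt0 : (0 < cost I O)%N.
  have /set0Pn[y yO] := O_neq0.
  by rewrite (costD1 _ yO) ltn_addr // posI // (subsetP (subI _ feasO)).
rewrite ler_pdivrMr ?ltr0n //.
apply: le_trans (cost_selected_le beta_ge1 instI run) _.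
(* [residual I x 0] is [I] itself, so [O] competes with the choice made at step 0. *)
by case: run => choice _ _; apply: agent_choice_le (choice 0 _) feasO O_neq0.
Qed.
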